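(* Fix an imprecise probabilities tree with finite state space $\mathscr{X}$, and let $\overline{\mathrm{E}}_{\mathrm V}$ be the corresponding game-theoretic upper expectation. For any situation $s\in\mathscr{X}^{\ast}$ and any non-increasing sequence $\{f_n\}_{n\in\mathbb{N}_0}$ of finitary, bounded above (extended real) variables on $\Omega$ that converges pointwise to a variable $f\colon\Omega\to\overline{\mathbb{R}}$, we have that \[\lim_{n\to+\infty}\overline{\mathrm{E}}_{\mathrm V}(f_n\vert s)=\overline{\mathrm{E}}_{\mathrm V}(f\vert s).\]
   Context: Notation: $\mathbb{N}=\{1,2,\dots\}$, $\mathbb{N}_0=\mathbb{N}\cup\{0\}$, $\overline{\mathbb{R}}=\mathbb{R}\cup\{-\infty,+\infty\}$, with conventions $+\infty-\infty=-\infty+\infty=+\infty$, $0\cdot(\pm\infty)=0$, $\inf\emptyset=+\infty$. For a non-empty set $\mathscr{Y}$, $\overline{\mathscr{L}}(\mathscr{Y})$ is the set of all maps $\mathscr{Y}\to\overline{\mathbb{R}}$ and $\overline{\mathscr{L}}_b(\mathscr{Y})$ the subset of those bounded below by a real constant; a variable $f$ is bounded above if $-f$ is bounded below. Limits and inequalities of functions are pointwise. Local models: $\mathscr{X}$ is a finite non-empty set. $\mathscr{X}^{\ast}=\bigcup_{n\in\mathbb{N}_0}\mathscr{X}^n$ is the set of situations (finite strings, including the empty string $\Box$). An imprecise probabilities tree assigns to each $s\in\mathscr{X}^{\ast}$ a map $\overline{\mathrm{Q}}_s\colon\overline{\mathscr{L}}(\mathscr{X})\to\overline{\mathbb{R}}$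 that is an upper expectation, i.e. satisfies: (E1) $\overline{\mathrm{Q}}_s(c)=c$ for all $c\in\mathbb{R}$; (E2) $\overline{\mathrm{Q}}_s(f+g)\le\overline{\mathrm{Q}}_s(f)+\overline{\mathrm{Q}}_s(g)$ for all $f,g\in\overline{\mathscr{L}}_b(\mathscr{X})$; (E3) $\overline{\mathrm{Q}}_s(\lambda f)=\lambda\overline{\mathrm{Q}}_s(f)$ for all real $\lambda>0$ and $f\in\overline{\mathscr{L}}_b(\mathscr{X})$; (E4) $f\le g\Rightarrow\overline{\mathrm{Q}}_s(f)\le\overline{\mathrm{Q}}_s(g)$ for all $f,g\in\overline{\mathscr{L}}_b(\mathscr{X})$; (E5) $\lim_n\overline{\mathrm{Q}}_s(f_n)=\overline{\mathrm{Q}}_s(\lim_n f_n)$ for every non-decreasing sequence $\{f_n\}_{n\in\mathbb{N}_0}$ of non-negative variables in $\overline{\mathscr{L}}_b(\mathscr{X})$. Global model: $\Omega=\mathscr{X}^{\mathbb{N}}$ is the set of paths; for $\omega\in\Omega$, $\omega^n\in\mathscr{X}^n$ is the string of its first $n$ values; $\Gamma(x_{1:n})=\{\omega\in\Omega:\omega^n=x_{1:n}\}$. For $g,h\colon\Omega\to\overline{\mathbb{R}}$, $g\ge_s h$ means $g(\omega)\ge h(\omega)$ for all $\omega\in\Gamma(s)$. A supermartingale is a map $\mathscr{M}\colon\mathscr{X}^{\ast}\to\overline{\mathbb{R}}$ with $\overline{\mathrm{Q}}_s(\mathscr{M}(s\,\cdot))\le\mathscr{M}(s)$ for all $s\in\mathscr{X}^{\ast}$,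 where $\mathscr{M}(s\,\cdot)\in\overline{\mathscr{L}}(\mathscr{X})$ is $x\mapsto\mathscr{M}(sx)$. $\overline{\mathbb{M}}_{\mathrm b}$ is the set of supermartingales bounded below by a real constant, and $\liminf\mathscr{M}(\omega)=\liminf_{n\to+\infty}\mathscr{M}(\omega^n)$. The game-theoretic upper expectation is, for all $f\colon\Omega\to\overline{\mathbb{R}}$ and $s\in\mathscr{X}^{\ast}$, \[\overline{\mathrm{E}}_{\mathrm V}(f\vert s)=\inf\{\mathscr{M}(s):\mathscr{M}\in\overline{\mathbb{M}}_{\mathrm b},\ \liminf\mathscr{M}\ge_s f\}.\] A variable $f\colon\Omega\to\overline{\mathbb{R}}$ is $n$-measurable if $f(\omega)$ depends only on $\omega^n$, and finitary if it is $n$-measurable for some $n\in\mathbb{N}_0$. *)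

(* Defs.v *)
From mathcomp Require Export all_boot all_order all_algebra.
From mathcomp Require Export all_classical all_reals all_analysis.

Set Implicit Arguments.
Unset Strict Implicit.
Unset Printing Implicit Defensive.

Export Order.TTheory GRing.Theory Num.Theory.
Export numFieldNormedType.Exports.

Local Open Scope classical_set_scope.
Local Open Scope ring_scope.
Local Open Scope ereal_scope.

Definition bounded_below_var (R : realType) (Y : Type) (f : Y -> \bar R) : Prop :=
  exists c : R, forall y, c%:E <= f y.

Definition bounded_above_var (R : realType) (Y : Type) (f : Y -> \bar R) : Prop :=
  bounded_below_var (fun y => - f y).

(* [dual_adde] is the addition of [\bar R] with +oo - oo = -oo + oo = +oo,
   whereas the default [+] would give -oo there. *)
Record upper_expectation (R : realType) (Y : Type)
    (Q : (Y -> \bar R) -> \bar R) : Prop := UpperExpectation {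
  upper_expectation_cst : forall c : R, Q (fun=> c%:E) = c%:E ;
  upper_expectation_subadd : forall f g : Y -> \bar R,
    bounded_below_var f -> bounded_below_var g ->
    Q (fun y => dual_adde (f y) (g y)) <= dual_adde (Q f) (Q g) ;
  upper_expectation_homog : forall (l : R) (f : Y -> \bar R),
    (0 < l)%R -> bounded_below_var f ->
    Q (fun y => l%:E * f y) = l%:E * Q f ;
  upper_expectation_mono : forall f g : Y -> \bar R,
    bounded_below_var f -> bounded_below_var g ->
    (forall y, f y <= g y) -> Q f <= Q g ;
  upper_expectation_cvg : forall f : nat -> Y -> \bar R,
    (forall n, bounded_below_var (f n)) ->
    (forall n y, 0 <= f n y) ->
    (forall n y, f n y <= f n.+1 y) ->
    (fun n => Q (f n)) @ \oo --> Q (fun y => limn (fun n => f n y))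
}.

(* A situation is a finite string [s : seq X], with [::] the empty string; its
   extension s x by one state is [rcons s x]. *)
Definition probability_tree (R : realType) (X : finType)
    (Q : seq X -> (X -> \bar R) -> \bar R) : Prop :=
  forall s, upper_expectation (Q s).

(* Paths are indexed from 0: [w i] is the (i+1)-th state of the path [w]. *)
Definition path_prefix (X : finType) (w : nat -> X) (n : nat) : seq X :=
  mkseq w n.

Definition cylinder_of (X : finType) (s : seq X) : set (nat -> X) :=
  [set w | path_prefix w (size s) = s].

Definition supermartingale (R : realType) (X : finType)
    (Q : seq X -> (X -> \bar R) -> \bar R) (M : seq X -> \bar R) : Prop :=
  forall s, Q s (fun x => M (rcons s x)) <= M s.

Definition path_liminf (R : realType) (X : finType) (M : seq X -> \bar R)
    (w : nat -> X) : \bar R :=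
  limn_einf (fun n => M (path_prefix w n)).

Definition game_upper_expectation (R : realType) (X : finType)
    (Q : seq X -> (X -> \bar R) -> \bar R)
    (f : (nat -> X) -> \bar R) (s : seq X) : \bar R :=
  ereal_inf [set M s | M in [set M : seq X -> \bar R |
    [/\ supermartingale Q M, bounded_below_var M &
        forall w, cylinder_of s w -> f w <= path_liminf M w]]].

Definition n_measurable (R : realType) (X : finType) (n : nat)
    (f : (nat -> X) -> \bar R) : Prop :=
  forall w w' : nat -> X, path_prefix w n = path_prefix w' n -> f w = f w'.

Definition finitary (R : realType) (X : finType)
    (f : (nat -> X) -> \bar R) : Prop :=
  exists n : nat, n_measurable n f.

(* Main.v *)
Require Import Defs.

Set Implicit Arguments.
Unset Strict Implicit.
Unset Printing Implicit Defensive.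

Local Open Scope classical_set_scope.
Local Open Scope ring_scope.
Local Open Scope ereal_scope.

(* If a supermartingale [M] satisfies [liminf M >= f] on the cylinder of [s],
   then [liminf M + e > f] there because [f < +oo] and [M] is bounded below.
   Every path through [s] hence has a prefix [u] extending [s] such that
   [f_ n <= M u + e] on the whole cylinder of [u], for some [n]; by compactness
   of the path space and monotonicity of [f_], a single [n] serves all paths.
   Stopping [M + e] at the first such prefix gives a supermartingale whose
   liminf dominates [f_ n], so the upper expectation of [f_ n] in [s] is at
   most [M s + e]. *)

Lemma size_path_prefix (X : finType) (w : nat -> X) (n : nat) :
  size (path_prefix w n) = n.
Proof. exact: size_mkseq. Qed.

Lemma take_path_prefix (X : finType) (w : nat -> X) (m n : nat) :
  (m <= n)%N -> take m (path_prefix w n) = path_prefix w m.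
Proof.
by move=> mn; rewrite /path_prefix /mkseq -map_take take_iota (minn_idPl mn).
Qed.

Lemma eq_path_prefix_le (X : finType) (w w' : nat -> X) (m n : nat) :
  (m <= n)%N -> path_prefix w n = path_prefix w' n ->
  path_prefix w m = path_prefix w' m.
Proof. by move=> mn eqn; rewrite -(take_path_prefix w mn) eqn take_path_prefix. Qed.

(** Sequential compactness of the path space, by a Konig argument: [X] is finite, so by pigeonhole a
    string that begins infinitely many [w_ n] has a one-state extension with the same property.
    Iterating from the empty string traces out [w]. *)
Lemma path_cluster_point (X : finType) (w_ : nat -> nat -> X) :
  exists w : nat -> X, forall m N : nat,
    exists2 n, (N <= n)%N & path_prefix (w_ n) m = path_prefix w m.
Proof.
pose frequent u := forall N : nat,
  exists2 n, (N <= n)%N & path_prefix (w_ n) (size u) = u.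
have step u : exists x, frequent u -> frequent (rcons u x).
  have [frequ|?] := pselect (frequent u); last by exists (w_ 0%N 0%N).
  have [//|nofreq] := pselect (exists x, frequent u -> frequent (rcons u x)).
  have /choice[B HB] x : exists B : nat, forall n, (B <= n)%N ->
      path_prefix (w_ n) (size (rcons u x)) <> rcons u x.
    apply: contrapT => /forallNP noB; apply: nofreq; exists x => _ N.
    have /existsNP[n /not_implyP[Nn /contrapT eqn]] := noB N.
    by exists n.
  (* An index beyond every bound [B x] still has [w_ n] passing through [u], and the next state
     [w_ n (size u)] then violates its own bound. *)
  have [n Bn eqn] := frequ (\max_x B x)%N.
  have := HB (w_ n (size u)) n (leq_trans (leq_bigmax _) Bn).
  by rewrite size_rcons /path_prefix mkseqS -/(path_prefix _ _) eqn.
have [nxt nxtP] := choice step.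
pose u_ m := iter m (fun u => rcons u (nxt u)) [::].
have u_freq m : frequent (u_ m).
  by elim: m => [N|m /nxtP//]; exists N.
exists (fun i => nxt (u_ i)) => m N.
have -> : path_prefix (fun i => nxt (u_ i)) m = u_ m.
  by elim: m => [//|m IH]; rewrite /path_prefix mkseqS -/(path_prefix _ _) IH.
have szu : size (u_ m) = m by elim: m => [//|m IH]; rewrite /= size_rcons IH.
by have [n Nn] := u_freq m N; rewrite szu; exists n.
Qed.

(* [find] returns [size t] on failure, so [stop_at P t] is [t] when no proper
   prefix of [t] satisfies [P]. *)
Definition stop_at (X : finType) (P : pred (seq X)) (t : seq X) : seq X :=
  take (find (fun k => P (take k t)) (iota 0 (size t))) t.

(** These are the two cases of the supermartingale inequality at [t]: either some prefix of [t],
    possibly [t] itself, satisfies [P] and the process is frozen, or none does and the process still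
    follows the original one. *)
Lemma stop_at_rcons (X : finType) (P : pred (seq X)) (t : seq X) :
  (forall x, stop_at P (rcons t x) = stop_at P t) \/
  (stop_at P t = t /\ forall x, stop_at P (rcons t x) = rcons t x).
Proof.
have take_le x k : (k <= size t)%N -> take k (rcons t x) = take k t.
  by move=> kt; rewrite -cats1 takel_cat.
have in_iota x : {in iota 0 (size t),
    (fun k => P (take k (rcons t x))) =1 (fun k => P (take k t))}.
  by move=> k; rewrite mem_iota /= => /ltnW kt; rewrite take_le.
have find_le : (find (fun k => P (take k t)) (iota 0 (size t)) <= size t)%N.
  by rewrite -[X in (_ <= X)%N](size_iota 0) find_size.
have stopE x : stop_at P (rcons t x) =
    if has (fun k => P (take k t)) (iota 0 (size t)) || P t
    then stop_at P t else rcons t x.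
  rewrite /stop_at size_rcons -(addn1 (size t)) iotaD find_cat.
  rewrite (eq_in_has (in_iota x)) (eq_in_find (in_iota x)) size_iota /=.
  case: ifPn => /= [_|nohas]; first exact: take_le.
  (* Only [t] itself is left to test. If [P t] holds, the search stops at index [size t], which is
     also the default value that makes [stop_at P t] equal to [t]. *)
  rewrite (take_le _ (size t)) // take_size; case: ifP => _.
    by rewrite addn0 take_le // (hasNfind nohas) size_iota.
  by rewrite take_oversize // size_rcons addn1.
have [hasP|nohas] := boolP (has (fun k => P (take k t)) (iota 0 (size t)) || P t).
  by left=> x; rewrite stopE hasP.
right; split=> [|x]; last by rewrite stopE (negbTE nohas).
move: nohas; rewrite negb_or => /andP[nohas _].
by rewrite /stop_at (hasNfind nohas) size_iota take_size.
Qed.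

Lemma stop_at_path_prefix (X : finType) (P : pred (seq X)) (w : nat -> X)
    (k m : nat) : P (path_prefix w k) -> (k < m)%N ->
  exists2 j, P (path_prefix w j) & stop_at P (path_prefix w m) = path_prefix w j.
Proof.
move=> Pk km; rewrite /stop_at size_path_prefix.
pose a := fun i => P (take i (path_prefix w m)); rewrite -/a.
have hasa : has a (iota 0 m).
  by apply/hasP; exists k; rewrite ?mem_iota //= /a take_path_prefix // ltnW.
have jm : (find a (iota 0 m) < m)%N by move: hasa; rewrite has_find size_iota.
exists (find a (iota 0 m)); last by rewrite take_path_prefix // ltnW.
by have := nth_find 0%N hasa; rewrite nth_iota // add0n /a take_path_prefix // ltnW.
Qed.

Lemma path_prefix_cylinder (X : finType) (w : nat -> X) (n : nat) :
  cylinder_of (path_prefix w n) w.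
Proof. by rewrite /cylinder_of /= size_path_prefix. Qed.

(** This is subadditivity against the constant [e]. Adding a real number never meets opposite
    infinities, so both additions of extended reals agree here. *)
Lemma upper_expectation_shift (R : realType) (Y : Type)
    (Q : (Y -> \bar R) -> \bar R) (g : Y -> \bar R) (e : R) :
  upper_expectation Q -> bounded_below_var g ->
  Q (fun y => g y + e%:E) <= Q g + e%:E.
Proof.
have dualE (x : \bar R) : dual_adde x e%:E = x + e%:E by case: x.
move=> Q_ue g_bd; under eq_fun do rewrite -dualE.
rewrite -dualE -[X in _ <= dual_adde _ X](upper_expectation_cst Q_ue e).
by apply: (upper_expectation_subadd Q_ue g_bd); exists e.
Qed.

Lemma stopped_supermartingale (R : realType) (X : finType)
    (Q : seq X -> (X -> \bar R) -> \bar R) (M : seq X -> \bar R)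
    (P : pred (seq X)) (e : R) :
  probability_tree Q -> supermartingale Q M -> bounded_below_var M ->
  supermartingale Q (fun t => M (stop_at P t) + e%:E).
Proof.
move=> Q_tree M_super [c cM] t.
have [stopE|[-> stopE]] := stop_at_rcons P t.
  (* Once stopped, the local variable is constant: a real value is preserved, [+oo] is trivial, and
     the lower bound on [M] excludes [-oo]. *)
  under eq_fun do rewrite stopE.
  have := cM (stop_at P t); case: (M _) => [r _||//].
    by rewrite -EFinD (upper_expectation_cst (Q_tree t)).
  by move=> _; exact: leey.
under eq_fun do rewrite stopE.
apply: (le_trans (upper_expectation_shift e (Q_tree t) _)); first by exists c.
exact: leeD2r.
Qed.

Lemma ge_limn_einf (R : realType) (u : nat -> \bar R) (N : nat) (a : \bar R) :
  (forall k, (N <= k)%N -> a <= u k) -> a <= limn_einf u.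
Proof.
move=> au; rewrite limn_einf_lim (cvg_lim _ (@cvg_einfs_sup _ u))//.
apply: (@le_trans _ _ (einfs u N)); last by apply: ereal_sup_ubound; exists N.
by apply: le_ereal_inf_tmp => _ [k Nk <-]; exact: au.
Qed.

Lemma lt_limn_einf (R : realType) (u : nat -> \bar R) (a : \bar R) :
  a < limn_einf u -> exists N : nat, forall k, (N <= k)%N -> a < u k.
Proof.
rewrite limn_einf_lim (cvg_lim _ (@cvg_einfs_sup _ u))//.
move=> /ereal_sup_gt[_ [N _ <-] aN]; exists N => k Nk.
by apply: (lt_le_trans aN); apply: ereal_inf_lbound; exists k.
Qed.

Lemma game_upper_expectation_mono (R : realType) (X : finType)
    (Q : seq X -> (X -> \bar R) -> \bar R) (f g : (nat -> X) -> \bar R)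
    (s : seq X) : (forall w, f w <= g w) ->
  game_upper_expectation Q f s <= game_upper_expectation Q g s.
Proof.
move=> fg; apply: le_ereal_inf => _ [M [M_super M_bd M_g] <-].
by exists M => //; split=> // w /M_g; exact: le_trans.
Qed.

Section decreasing_finitary.
Variables (R : realType) (X : finType).
Variables (f_ : nat -> (nat -> X) -> \bar R) (f : (nat -> X) -> \bar R).
Hypothesis f_finitary : forall n, finitary (f_ n).
Hypothesis f_lty : forall n w, f_ n w < +oo.
Hypothesis f_anti : forall m n w, (m <= n)%N -> f_ n w <= f_ m w.
Hypothesis f_inf : forall w, f w = ereal_inf (range (f_ ^~ w)).
Variables (M : seq X -> \bar R) (s : seq X) (e : R).
Hypothesis M_bd : bounded_below_var M.
Hypothesis M_f : forall w, cylinder_of s w -> f w <= path_liminf M w.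
Hypothesis e_gt0 : (0 < e)%R.

Definition dominated (n : nat) (u : seq X) : Prop :=
  forall w, cylinder_of u w -> f_ n w <= M u + e%:E.

Lemma dominated_prefix (w : nat -> X) : cylinder_of s w ->
  exists n k, (size s <= k)%N /\ dominated n (path_prefix w k).
Proof.
move=> sw; have [c cM] := M_bd.
have f_lt : f w < path_liminf M w + e%:E.
  have cL : c%:E <= path_liminf M w by apply: (@ge_limn_einf _ _ 0%N).
  move: cL (M_f sw); case: (path_liminf M w) => [r _|_ _|//].
    by move=> /le_lt_trans; apply; rewrite -EFinD lte_fin ltrDl.
  (* If the liminf is [+oo], strictness comes from [f w <= f_ 0 w < +oo]. *)
  rewrite f_inf; apply: (le_lt_trans _ (f_lty 0%N w)).
  by apply: ereal_inf_lbound; exists 0%N.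
move: f_lt; rewrite f_inf => /ereal_inf_lt[_ [n _ <-]].
rewrite -lteBlDr// => /lt_limn_einf[N NM].
have [d fd] := f_finitary n.
(* The depth has to reach [s], determine the value of [f_ n] (depth [d]), and lie where [M] along
   [w] exceeds [f_ n w - e] (depth [N]). *)
exists n, (maxn (size s) (maxn d N)); split; first exact: leq_maxl.
move=> w'; rewrite /cylinder_of /= size_path_prefix => eqw.
rewrite (fd w' w); last first.
  by apply: eq_path_prefix_le eqw; rewrite !leq_max leqnn orbT.
rewrite -leeBlDr//; apply/ltW/NM.
by rewrite !leq_max leqnn !orbT.
Qed.

(** Otherwise pick for each [n] a path [w_ n] without a suitable prefix. A cluster point has a
    prefix dominated at some level [n]; some [w_ n'] with [n' >= n] shares it, and it stays
    dominated at level [n'] because [f_] decreases. *)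
Lemma dominated_uniform : exists n, forall w, cylinder_of s w ->
  exists2 k, (size s <= k)%N & dominated n (path_prefix w k).
Proof.
apply: contrapT => /forallNP no_n.
have /choice[w_ w_P] n : exists w, cylinder_of s w /\
    forall k, (size s <= k)%N -> ~ dominated n (path_prefix w k).
  have /existsNP[w /not_implyP[sw no_k]] := no_n n.
  by exists w; split=> // k sk domk; apply: no_k; exists k.
have [w clw] := path_cluster_point w_.
have sw : cylinder_of s w.
  by have [n _ eqw] := clw (size s) 0%N; rewrite /cylinder_of /= -eqw; case: (w_P n).
have [n [k [sk dom]]] := dominated_prefix sw.
have [n' nn' eqw] := clw k n.
have [_ /(_ k sk)] := w_P n'; apply; rewrite eqw => w' /dom.
exact/le_trans/f_anti.
Qed.

Lemma game_upper_expectation_dominated (Q : seq X -> (X -> \bar R) -> \bar R) :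
  probability_tree Q -> supermartingale Q M ->
  exists n, game_upper_expectation Q (f_ n) s <= M s + e%:E.
Proof.
move=> Q_tree M_super; have [n n_dom] := dominated_uniform; exists n.
(* The length condition forbids stopping at a proper prefix of [s], so the stopped process has value
   [M s + e] at [s]. *)
pose P u := `[< (size s <= size u)%N /\ dominated n u >].
apply: ge_ereal_inf; exists (M (stop_at P s) + e%:E).
  exists (fun t => M (stop_at P t) + e%:E) => //; split.
  - exact: stopped_supermartingale.
  - by have [c cM] := M_bd; exists (c + e)%R => t; rewrite EFinD leeD2r.
  (* From length [k.+1] on, the prefix of length [k] is a proper one, so stopping has occurred at a
     dominated prefix of [w], perhaps an earlier one. *)
  move=> w /n_dom[k sk domk]; apply: (@ge_limn_einf _ _ k.+1) => m km.
  have Pk : P (path_prefix w k) by apply/asboolP; rewrite size_path_prefix.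
  have [j /asboolP[_ domj] ->] := stop_at_path_prefix Pk km.
  exact/domj/path_prefix_cylinder.
suff -> : stop_at P s = s by [].
rewrite /stop_at hasNfind ?size_iota ?take_size//.
apply/hasPn => k; rewrite mem_iota /= => ks.
by apply/asboolP; rewrite size_takel ?(ltnW ks)// leqNgt ks => -[].
Qed.

End decreasing_finitary.

Theorem theorem31 (R : realType) (X : finType) (X_nonempty : (0 < #|X|)%N)
    (Q : seq X -> (X -> \bar R) -> \bar R) (Q_tree : probability_tree Q)
    (s : seq X) (f_ : nat -> (nat -> X) -> \bar R) (f : (nat -> X) -> \bar R)
    (f_finitary : forall n, finitary (f_ n))
    (f_bounded : forall n, bounded_above_var (f_ n))
    (f_nonincreasing : forall n w, f_ n.+1 w <= f_ n w)
    (f_cvg : forall w, (fun n => f_ n w) @ \oo --> f w) :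
  (fun n => game_upper_expectation Q (f_ n) s) @ \oo
    --> game_upper_expectation Q f s.
Proof.
have f_anti m n w : (m <= n)%N -> f_ n w <= f_ m w.
  apply: (@homo_leq _ (f_ ^~ w) (fun x y => y <= x)) => // y x z xy yz.
  exact: le_trans xy.
have f_lty n w : f_ n w < +oo.
  by have [c /(_ w)] := f_bounded n; case: (f_ n w) => // r _; rewrite ltry.
have f_inf w : f w = ereal_inf (range (f_ ^~ w)).
  apply: (cvg_unique _ (f_cvg w)) => //; apply: ereal_nonincreasing_cvgn => m n.
  exact: f_anti.
have E_anti m n : (m <= n)%N ->
    game_upper_expectation Q (f_ n) s <= game_upper_expectation Q (f_ m) s.
  by move=> mn; apply: game_upper_expectation_mono => w; exact: f_anti.
suff -> : game_upper_expectation Q f s =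
    ereal_inf (range (fun n => game_upper_expectation Q (f_ n) s)).
  exact: ereal_nonincreasing_cvgn.
apply/eqP; rewrite eq_le; apply/andP; split.
  apply: le_ereal_inf_tmp => _ [n _ <-]; apply: game_upper_expectation_mono => w.
  by rewrite f_inf; apply: ereal_inf_lbound; exists n.
(* The substantial inequality: any [M] admissible for [f] bounds the infimum up to an arbitrary
   [e > 0]. *)
apply: le_ereal_inf_tmp => _ [M [M_super M_bd M_f] <-].
apply/lee_addgt0Pr => e e_gt0.
have [n En] := game_upper_expectation_dominated f_finitary f_lty f_anti f_inf
  M_bd M_f e_gt0 Q_tree M_super.
by apply: (le_trans _ En); apply: ereal_inf_lbound; exists n.
Qed.
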